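(* Let $H$ be a weak bialgebra over a field $\mathbf{k}$ with target map $\Pi^L:H\to H$, $\Pi^L(h)=\varepsilon(1_1h)1_2$, and let $H^L=\Pi^L(H)$, acting on $H$ by left multiplication. Then $(H,\Pi^L)$ is a generic Rota-Baxter paired $H^L$-module of weight $-1$. Further, $(H^L,\Pi^L)$ (with $\Pi^L$ restricted to $H^L$) is a Rota-Baxter algebra of weight $-1$.
   Context: Sweedler notation $\Delta(h)=h_1\otimes h_2$ is used, and $\Delta(1_H)=1_1\otimes 1_2$. A weak bialgebra over $\mathbf{k}$ is a $\mathbf{k}$-vector space $H$ that is both a (unital associative) algebra and a (counital coassociative) coalgebra such that for all $x,y,z\in H$: (i) $\Delta(xy)=\Delta(x)\Delta(y)$; (ii) $\varepsilon(xyz)=\varepsilon(xy_1)\varepsilon(y_2z)=\varepsilon(xy_2)\varepsilon(y_1z)$; (iii) $\Delta^2(1_H)=(\Delta(1_H)\otimes 1_H)(1_H\otimes\Delta(1_H))=(1_H\otimes\Delta(1_H))(\Delta(1_H)\otimes 1_H)$, where $\Delta^2=(\Delta\otimes\mathrm{id}_H)\circ\Delta$. For an algebra $B$, a left $B$-module $M$ and $\mathbf{k}$-linear maps $P:B\to B$, $T:M\to M$, the triple $(M,P,T)$ is a Rota-Baxter paired $B$-module of weight $\lambda\in\mathbf{k}$ if $$P(b)\cdot T(m)=T(P(b)\cdot m)+T(b\cdot T(m))+\lambda T(b\cdot m)\quad\text{for all } b\in B,\ m\in M.$$ The pair $(M,T)$ is a generic Rota-Baxter paired $B$-module of weight $\lambda$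 if this holds for every $\mathbf{k}$-linear map $P:B\to B$. A Rota-Baxter algebra of weight $\lambda$ is a pair $(B,P)$ of an algebra $B$ and a linear map $P:B\to B$ with $P(x)P(y)=P(P(x)y)+P(xP(y))+\lambda P(xy)$ for all $x,y\in B$. *)

(* Defs.v *)
From HB Require Import structures.
From mathcomp Require Import all_boot all_algebra.
From mathcomp Require Import boolp classical_sets.
From mathcomp Require Import freeg.

Set Implicit Arguments.
Unset Strict Implicit.
Unset Printing Implicit Defensive.

Import GRing.Theory.
Local Open Scope ring_scope.

Reserved Notation "u ⊗ v" (at level 38, left associativity).
Reserved Notation "\sw_ ( a , b <- t ) E"
  (at level 41, E at level 41, a, b at level 0, t at level 50,
   format "\sw_ ( a ,  b  <-  t )  E").

Local Notation bilin f := (bilinear_for *:%R *:%R f).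

(* MathComp algebras satisfy 1 != 0; this lemma yields 1 ⊗ 1 != 0 below, in
   arbitrary dimension. *)
Lemma linear_functional (k : fieldType) (V : lmodType k) (v : V) :
  v != 0 -> exists f : {scalar V}, f v = 1.
Proof.
move=> v_neq0.
pose P (S : set V) := (S 0 /\ (forall c x y, S x -> S y -> S (c *: x + y))
   /\ ~ S v) \/ S = set0.
have [|S [PS Smax]] := @Zorn_bigcup V P.
  move=> F FP Ftot.
  have [[X [FX X0]]|noX] := pselect (exists X, F X /\ X <> set0); last first.
    right; apply/seteqP; split=> // x [X FX Xx].
    by case: noX; exists X; split=> // X0; rewrite X0 in Xx.
  left; split; first by exists X => //; case: (FP _ FX) => [[]|/X0].
  split.
    move=> c x y [Y FY Yx] [Z FZ Zy].
    have sub W x' : F W -> W x' -> forall c x y, W x -> W y -> W (c *: x + y).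
      by move=> FW Wx'; case: (FP _ FW) => [[_ []]|W0] //; rewrite W0 in Wx'.
    have [YZ|ZY] := Ftot _ _ FY FZ.
    - by exists Z => //; apply: (sub Z y) => //; apply: YZ.
    - by exists Y => //; apply: (sub Y x) => //; apply: ZY.
  by move=> [Y FY Yv]; case: (FP _ FY) => [[_ []]|Y0] //; rewrite Y0 in Yv.
have {PS} [S0 [Slin Sv]] : S 0 /\ (forall c x y, S x -> S y -> S (c *: x + y))
   /\ ~ S v.
  case: PS => // S0; exfalso.
  apply: (Smax [set 0]%classic); first by rewrite S0; split=> // /(_ 0); exact.
  left; split=> //; split=> [c x y -> ->|/= v0]; first by rewrite scaler0 addr0.
  by rewrite v0 eqxx in v_neq0.
have SD x y : S x -> S y -> S (x + y).
  by move=> Sx Sy; have := Slin 1 _ _ Sx Sy; rewrite scale1r.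
have SZ c x : S x -> S (c *: x).
  by move=> Sx; have := Slin c _ _ Sx S0; rewrite addr0.
have Sdec x : exists c, S (x - c *: v).
  have [Sx|Sx] := pselect (S x); first by exists 0; rewrite scale0r subr0.
  pose S' := [set y | exists c, S (y - c *: x)]%classic.
  have SS' : (S `<` S')%classic.
    split=> [y Sy|]; first by exists 0; rewrite scale0r subr0.
    move=> /(_ x); apply: contra_not Sx; apply; exists 1.
    by rewrite scale1r subrr.
  have nPS' := Smax _ SS'.
  have [c Sc] : S' v.
    apply: contrapT => S'v; apply: nPS'; left; split.
      by exists 0; rewrite scale0r subr0.
    split=> // c y z [d Sd] [e Se]; exists (c * d + e).
    suff -> : c *: y + z - (c * d + e) *: x = c *: (y - d *: x) + (z - e *: x).
      exact: Slin.
    by rewrite scalerBr scalerDl opprD scalerA addrACA.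
  have c0 : c != 0 by apply/eqP => c0; rewrite c0 scale0r subr0 in Sc.
  exists c^-1; have := SZ (- c^-1) _ Sc.
  by rewrite scalerBr scalerA mulNr mulVf // scaleN1r opprK addrC scaleNr.
have Suniq x c d : S (x - c *: v) -> S (x - d *: v) -> c = d.
  move=> Sc Sd; apply/eqP; rewrite -subr_eq0; apply/eqP.
  apply: contrapT => /eqP cd.
  have := SZ (c - d)^-1 _ (SD _ _ Sd (SZ (-1) _ Sc)).
  rewrite scaleN1r opprB [X in _ *: X]addrC addrA subrK -scalerBl.
  rewrite scalerA mulVf // scale1r.
  exact: Sv.
have /choice [f fP] := Sdec.
have f_lin : linear_for *%R f.
  move=> a x y; apply: (Suniq (a *: x + y)) => //.
  rewrite scalerDl opprD addrACA -scalerA -scalerBr; exact: Slin.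
pose fL := GRing.isLinear.Build k V k *%R f f_lin.
pose fS : {scalar V} := HB.pack f fL.
exists fS; apply: (Suniq v) => //=.
by rewrite scale1r subrr.
Qed.

Section TensorProduct.
Variables (k : fieldType) (U V : lmodType k).

Local Notation free := {freeg (U * V) / k}.
Local Notation "[[ u , v ]]" := (<< (u, v) >> : free).

(* The subspace of the free vector space on U * V spanned by the bilinearity
   relators; the tensor product is the quotient by it. *)
Inductive tensor_relation : free -> Prop :=
| tensor_rel0 : tensor_relation 0
| tensor_relP c x y :
    tensor_relation x -> tensor_relation y -> tensor_relation (c *: x + y)
| tensor_rell c u1 u2 v :
    tensor_relation ([[c *: u1 + u2, v]] - (c *: [[u1, v]] + [[u2, v]]))
| tensor_relr c u v1 v2 :
    tensor_relation ([[u, c *: v1 + v2]] - (c *: [[u, v1]] + [[u, v2]])).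

Definition tensor_relations : {pred free} := [pred x | `[< tensor_relation x >]].

Lemma tensor_relations_zmod : zmod_closed tensor_relations.
Proof.
split=> [|x y /asboolP Rx /asboolP Ry]; apply/asboolP.
  exact: tensor_rel0.
by rewrite addrC -scaleN1r; apply: tensor_relP.
Qed.

HB.instance Definition _ :=
  GRing.isZmodClosed.Build free tensor_relations tensor_relations_zmod.

Definition tensor := Quotient.quot tensor_relations.
HB.instance Definition _ := GRing.Zmodule.on tensor.

Let p (x : free) : tensor := \pi_(Quotient.quot tensor_relations)%qT x.

Let p_eq x y : p x = p y <-> tensor_relation (x - y).
Proof.
split=> [/eqP|Rxy]; first by rewrite /p -Quotient.idealrBE => /asboolP.
by apply/eqP; rewrite /p -Quotient.idealrBE; apply/asboolP.
Qed.

Let pD x y : p (x + y) = p x + p y.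
Proof. by rewrite /p raddfD. Qed.

Let pK t : p (repr t) = t.
Proof. exact: reprK. Qed.

Definition tensor_scale (c : k) (t : tensor) : tensor := p (c *: repr t).

Let pZ c x : p (c *: x) = tensor_scale c (p x).
Proof.
apply/p_eq; rewrite -scalerBr -[_ *: _]addr0; apply: tensor_relP tensor_rel0.
by apply/p_eq; rewrite pK.
Qed.

Let tensor_scaleA a b t :
  tensor_scale a (tensor_scale b t) = tensor_scale (a * b) t.
Proof. by rewrite -[t]pK -!pZ scalerA. Qed.

Let tensor_scale1 : left_id 1 tensor_scale.
Proof. by move=> t; rewrite -[t]pK -!pZ scale1r. Qed.

Let tensor_scaleDr : right_distributive tensor_scale +%R.
Proof. by move=> a s t; rewrite -[s]pK -[t]pK -!(pZ, pD) scalerDr. Qed.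

Let tensor_scaleDl t : {morph tensor_scale^~ t : a b / a + b}.
Proof. by move=> a b; rewrite -[t]pK -!(pZ, pD) scalerDl. Qed.

HB.instance Definition _ := GRing.Zmodule_isLmodule.Build k tensor
  tensor_scaleA tensor_scale1 tensor_scaleDr tensor_scaleDl.

Let p_scale c x : p (c *: x) = c *: p x. Proof. exact: pZ. Qed.

Definition tens (u : U) (v : V) : tensor := p [[u, v]].

Lemma tens_bilin : bilin tens.
Proof.
split=> [v c u1 u2|u c v1 v2] /=.
  transitivity (p (c *: [[u1, v]] + [[u2, v]])); last by rewrite pD p_scale.
  exact/p_eq/tensor_rell.
transitivity (p (c *: [[u, v1]] + [[u, v2]])); last by rewrite pD p_scale.
exact/p_eq/tensor_relr.
Qed.

(* If a class t is represented by the formal combination of c_i (u_i, v_i), then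
   [tlift f t] is the sum of the c_i *: f u_i v_i. It does not depend on the
   representative when f is bilinear (tlift_tens, tlift_linear). *)
Definition tlift (W : lmodType k) (f : U -> V -> W) (t : tensor) : W :=
  fglift (fun uv => f uv.1 uv.2) (repr t).

Section Lift.
Variables (W : lmodType k) (f : U -> V -> W).
Hypothesis f_bilin : bilin f.
Let F : free -> W := fglift (fun uv => f uv.1 uv.2).

Let F_lin : linear F.
Proof.
pose Fadd := GRing.isZmodMorphism.Build _ _ F (lift_is_additive _).
pose FA : {additive free -> W} := HB.pack F Fadd.
have FE (g : U * V -> k) s : F (\sum_(z <- s) << g z *g z >>)
    = \sum_(z <- s) g z *: f z.1 z.2.
  by rewrite -[F]/(FA : _ -> _) raddf_sum; apply: eq_bigr => z _; exact: liftU.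
have FZ c x : F (c *: x) = c *: F x.
  rewrite -[in RHS](freeg_sumE x) [in RHS]FE scaler_sumr [LHS]FE.
  by apply: eq_bigr => z _; rewrite scalerA.
by move=> c x y; rewrite -FZ -[F]/(FA : _ -> _) raddfD.
Qed.

Let F_gen u v : F [[u, v]] = f u v.
Proof. by rewrite /F liftU scale1r. Qed.

Let F_rel x : tensor_relation x -> F x = 0.
Proof.
pose FL : {linear free -> W} :=
  HB.pack F (GRing.isLinear.Build k free W *:%R F F_lin).
rewrite -[F]/(FL : _ -> _); elim=> [|c y z _ Fy _ Fz|c u1 u2 v|c u v1 v2].
- exact: linear0.
- by rewrite linearP Fy Fz scaler0 addr0.
- by rewrite linearB linearP /= !F_gen f_bilin.1 subrr.
- by rewrite linearB linearP /= !F_gen f_bilin.2 subrr.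
Qed.

Let tlift_p x : tlift f (p x) = F x.
Proof.
pose FL : {linear free -> W} :=
  HB.pack F (GRing.isLinear.Build k free W *:%R F F_lin).
apply/eqP; rewrite -subr_eq0 -[tlift f _]/(FL _) -[F x]/(FL _) -linearB.
by apply/eqP; apply: F_rel; apply/p_eq; rewrite pK.
Qed.

Lemma tlift_tens u v : tlift f (tens u v) = f u v.
Proof. by rewrite tlift_p F_gen. Qed.

Lemma tlift_linear : linear (tlift f).
Proof.
by move=> c s t; rewrite -[s]pK -[t]pK -p_scale -pD !tlift_p F_lin.
Qed.
End Lift.

Lemma tensor_ind (Q : tensor -> Prop) :
  (forall u v, Q (tens u v)) ->
  (forall c s t, Q s -> Q t -> Q (c *: s + t)) -> forall t, Q t.
Proof.
move=> Qtens QP t; rewrite -[t]pK -(freeg_sumE (repr t)).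
elim/big_rec: _ => [|[u v] x _ Qx].
  rewrite -[0](subrr [[0, 0]]) addrC -scaleN1r pD p_scale.
  by apply: QP; exact: Qtens.
suff -> : << coeff (u, v) (repr t) *g (u, v) >>
    = coeff (u, v) (repr t) *: [[u, v]].
  by rewrite pD p_scale; apply: QP => //; exact: Qtens.
by apply/eqP/freeg_eqP => z; rewrite coeffZ !coeffU mul1r.
Qed.

End TensorProduct.

Arguments tensor {k} (U V)%_type.
Notation "U ⊗ V" := (tensor U V) : type_scope.
Notation "u ⊗ v" := (tens u v) : ring_scope.
(* Sweedler notation: if t = t_1 ⊗ t_2 (summation understood), this is the value
   of E at a = t_1, b = t_2; meaningful only when E is bilinear in a and b. *)
Notation "\sw_ ( a , b <- t ) E" := (tlift (fun a b => E) t) : ring_scope.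

Section TensorTheory.
Variable k : fieldType.
Implicit Types U V W : lmodType k.

Lemma linear_ext_tens U V W (f g : U ⊗ V -> W) :
  linear f -> linear g -> (forall u v, f (u ⊗ v) = g (u ⊗ v)) -> f =1 g.
Proof.
move=> fL gL fg; elim/tensor_ind => // c s t fgs fgt.
by rewrite fL gL fgs fgt.
Qed.

Lemma tlift_linear_param U V W (X : lmodType k) (f : X -> U -> V -> W) :
  (forall x, bilin (f x)) -> (forall u v, linear (fun x => f x u v)) ->
  forall t, linear (fun x => tlift (f x) t).
Proof.
move=> fB fL t c x y /=; elim/tensor_ind: t => [u v|d s t IHs IHt].
  by rewrite !tlift_tens // fL.
by rewrite !tlift_linear // IHs IHt !scalerDr addrACA !scalerA [d * c]mulrC.
Qed.

Lemma tens0l U V (v : V) : (0 : U) ⊗ v = 0.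
Proof.
have := (tens_bilin U V).1 v 1 0 0; rewrite /= !scale1r addr0.
by rewrite -[X in X = _]addr0 => /addrI.
Qed.

Lemma tens0r U V (u : U) : u ⊗ (0 : V) = 0.
Proof.
have := (tens_bilin U V).2 u 1 0 0; rewrite /= !scale1r addr0.
by rewrite -[X in X = _]addr0 => /addrI.
Qed.

Lemma tensZl U V c (u : U) (v : V) : (c *: u) ⊗ v = c *: (u ⊗ v).
Proof. by rewrite -[c *: u]addr0 (tens_bilin _ _).1 tens0l addr0. Qed.

Lemma tensZr U V c (u : U) (v : V) : u ⊗ (c *: v) = c *: (u ⊗ v).
Proof. by rewrite -[c *: v]addr0 (tens_bilin _ _).2 tens0r addr0. Qed.

Lemma tensPl U V c (u1 u2 : U) (v : V) :
  (c *: u1 + u2) ⊗ v = c *: (u1 ⊗ v) + u2 ⊗ v.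
Proof. exact: (tens_bilin _ _).1. Qed.

Lemma tensPr U V c (u : U) (v1 v2 : V) :
  u ⊗ (c *: v1 + v2) = c *: (u ⊗ v1) + u ⊗ v2.
Proof. exact: (tens_bilin _ _).2. Qed.

Definition tmap U V U' V' (f : U -> U') (g : V -> V') (t : U ⊗ V) : U' ⊗ V' :=
  \sw_(u, v <- t) f u ⊗ g v.

Definition tassoc U V W (t : U ⊗ (V ⊗ W)) : (U ⊗ V) ⊗ W :=
  \sw_(u, s <- t) \sw_(v, w <- s) (u ⊗ v) ⊗ w.

Lemma tmap_bilin U V U' V' (f : {linear U -> U'}) (g : {linear V -> V'}) :
  bilin (fun u v => f u ⊗ g v).
Proof.
split=> [v c u1 u2|u c v1 v2] /=; rewrite linearP.
  exact: (tens_bilin _ _).1.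
exact: (tens_bilin _ _).2.
Qed.

Lemma tmap_tens U V U' V' (f : {linear U -> U'}) (g : {linear V -> V'}) u v :
  tmap f g (u ⊗ v) = f u ⊗ g v.
Proof. by rewrite /tmap tlift_tens //; exact: tmap_bilin. Qed.

Lemma tmap_linear U V U' V' (f : {linear U -> U'}) (g : {linear V -> V'}) :
  linear (tmap f g).
Proof. exact/tlift_linear/tmap_bilin. Qed.

HB.instance Definition _ U V U' V' (f : {linear U -> U'}) (g : {linear V -> V'}) :=
  GRing.isLinear.Build k _ _ *:%R (tmap f g) (tmap_linear f g).

Section Assoc.
Variables U V W : lmodType k.

Let assoc1_bilin u : bilin (fun (v : V) (w : W) => ((u : U) ⊗ v) ⊗ w).
Proof.
split=> [w c v1 v2|v c w1 w2] /=; last exact: (tens_bilin _ _).2.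
by rewrite (tens_bilin _ _).2 (tens_bilin _ _).1.
Qed.

Let assoc2_bilin :
  bilin (fun (u : U) (s : V ⊗ W) => \sw_(v, w <- s) (u ⊗ v) ⊗ w).
Proof.
split=> [s|u]; last exact: tlift_linear.
apply: tlift_linear_param => // v w c u1 u2 /=.
by rewrite (tens_bilin _ _).1 (tens_bilin _ _).1.
Qed.

Lemma tassoc_tens (u : U) (v : V) (w : W) :
  tassoc (u ⊗ (v ⊗ w)) = (u ⊗ v) ⊗ w.
Proof. by rewrite /tassoc tlift_tens // tlift_tens. Qed.

Lemma tassoc_linear : linear (@tassoc U V W).
Proof. exact: tlift_linear. Qed.

HB.instance Definition _ :=
  GRing.isLinear.Build k _ _ *:%R (@tassoc U V W) tassoc_linear.

End Assoc.

End TensorTheory.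

Section TensorAlgebra.
Variables (k : fieldType) (A B : algType k).
Implicit Types s t u : A ⊗ B.

Definition tensor_mul s t : A ⊗ B :=
  \sw_(a, b <- s) \sw_(c, d <- t) (a * c) ⊗ (b * d).

Let mul1_bilin a b : bilin (fun c d => (a * c : A) ⊗ (b * d : B)).
Proof.
by split=> [d e c1 c2|c e d1 d2] /=; rewrite mulrDr -scalerAr;
  [exact: (tens_bilin _ _).1|exact: (tens_bilin _ _).2].
Qed.

Let mul2_bilin t :
  bilin (fun a b => \sw_(c, d <- t) (a * c : A) ⊗ (b * d : B)).
Proof.
by split=> [b|a]; apply: tlift_linear_param => // c d e x1 x2 /=;
  rewrite mulrDl -scalerAl; [exact: (tens_bilin _ _).1|exact: (tens_bilin _ _).2].
Qed.

Lemma tensor_mul_tens a b c d :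
  tensor_mul (a ⊗ b) (c ⊗ d) = (a * c) ⊗ (b * d).
Proof. by rewrite /tensor_mul tlift_tens // tlift_tens. Qed.

Let mulPl t : linear (tensor_mul^~ t).
Proof. exact: tlift_linear. Qed.

Let mulPr s : linear (tensor_mul s).
Proof.
apply: tlift_linear_param => // a b; exact: tlift_linear.
Qed.

Let tensor_mulA : associative tensor_mul.
Proof.
move=> s t u.
elim/tensor_ind: s => [a b|e s1 s2 IH1 IH2]; last by rewrite !mulPl IH1 IH2.
elim/tensor_ind: t => [c d|e s1 s2 IH1 IH2]; last first.
  by rewrite !(mulPl, mulPr) IH1 IH2.
elim/tensor_ind: u => [x y|e s1 s2 IH1 IH2]; last by rewrite !mulPr IH1 IH2.
by rewrite !tensor_mul_tens !mulrA.
Qed.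

Let tensor_mul1l : left_id (1 ⊗ 1) tensor_mul.
Proof.
elim/tensor_ind=> [a b|e s1 s2 IH1 IH2]; last by rewrite mulPr IH1 IH2.
by rewrite tensor_mul_tens !mul1r.
Qed.

Let tensor_mul1r : right_id (1 ⊗ 1) tensor_mul.
Proof.
elim/tensor_ind=> [a b|e s1 s2 IH1 IH2]; last by rewrite mulPl IH1 IH2.
by rewrite tensor_mul_tens !mulr1.
Qed.

Let tensor_mulDl : left_distributive tensor_mul +%R.
Proof. by move=> s t u; have := mulPl u 1 s t; rewrite !scale1r. Qed.

Let tensor_mulDr : right_distributive tensor_mul +%R.
Proof. by move=> s t u; have := mulPr s 1 t u; rewrite !scale1r. Qed.

Let tensor_1neq0 : (1 : A) ⊗ (1 : B) != 0.
Proof.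
have [f f1] := linear_functional (oner_neq0 A).
have [g g1] := linear_functional (oner_neq0 B).
pose h (a : A) (b : B) : k^o := f a * g b.
have h_bilin : bilin h.
  split=> [b c a1 a2|a c b1 b2]; rewrite /h /= linearP.
    by rewrite mulrDl -mulrA.
  by rewrite mulrDr mulrCA.
apply/eqP => /(congr1 (tlift h)).
rewrite tlift_tens // /h f1 g1 mul1r -[0](subrr 0) addrC -scaleN1r.
rewrite tlift_linear // scaleN1r addrC subrr => /eqP; exact/negP/oner_neq0.
Qed.

HB.instance Definition _ := GRing.Zmodule_isNzRing.Build (A ⊗ B)%type
  tensor_mulA tensor_mul1l tensor_mul1r tensor_mulDl tensor_mulDr tensor_1neq0.

Lemma tensor_oneE : 1 = 1 ⊗ 1 :> A ⊗ B. Proof. by []. Qed.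

Lemma tensor_mulE (a c : A) (b d : B) :
  (a ⊗ b) * (c ⊗ d) = (a * c) ⊗ (b * d).
Proof. exact: tensor_mul_tens. Qed.

Lemma tensor_mulPl (c : k) (s1 s2 t : A ⊗ B) :
  (c *: s1 + s2) * t = c *: (s1 * t) + s2 * t.
Proof. exact: mulPl. Qed.

Lemma tensor_mulPr (c : k) (s t1 t2 : A ⊗ B) :
  s * (c *: t1 + t2) = c *: (s * t1) + s * t2.
Proof. exact: mulPr. Qed.

Let tensor_scaleAl (e : k) (s t : A ⊗ B) : e *: (s * t) = (e *: s) * t.
Proof.
pose f : {linear (A ⊗ B)%type -> (A ⊗ B)%type} :=
  HB.pack (tensor_mul^~ t) (GRing.isLinear.Build k _ _ *:%R _ (mulPl t)).
by rewrite -[LHS]/(e *: f s) -linearZ.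
Qed.

HB.instance Definition _ :=
  GRing.Lmodule_isLalgebra.Build k (A ⊗ B)%type tensor_scaleAl.

Let tensor_scaleAr (e : k) (s t : A ⊗ B) : e *: (s * t) = s * (e *: t).
Proof.
pose f : {linear (A ⊗ B)%type -> (A ⊗ B)%type} :=
  HB.pack (tensor_mul s) (GRing.isLinear.Build k _ _ *:%R _ (mulPr s)).
by rewrite -[LHS]/(e *: f t) -linearZ.
Qed.

HB.instance Definition _ :=
  GRing.Lalgebra_isAlgebra.Build k (A ⊗ B)%type tensor_scaleAr.

End TensorAlgebra.

HB.mixin Record isCoalgebra (k : fieldType) C of GRing.Lmodule k C := {
  comul : {linear C -> (C ⊗ C)%type};
  counit : {scalar C};
  comulA : forall c : C,
    tmap comul idfun (comul c) = tassoc (tmap idfun comul (comul c));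
  counitl : forall c : C, \sw_(c1, c2 <- comul c) counit c1 *: c2 = c;
  counitr : forall c : C, \sw_(c1, c2 <- comul c) counit c2 *: c1 = c
}.

#[short(type="coalgType")]
HB.structure Definition Coalgebra (k : fieldType) :=
  {C of GRing.Lmodule k C & isCoalgebra k C}.

HB.mixin Record isWeakBialgebra (k : fieldType) H
    of GRing.Algebra k H & Coalgebra k H := {
  (* the product on the right is that of the algebra H ⊗ H *)
  comulM : forall x y : H, comul (x * y) = comul x * comul y :> H ⊗ H;
  counitM12 : forall x y z : H, counit (x * y * z) =
    \sw_(y1, y2 <- comul y) (counit (x * y1) * counit (y2 * z) : k^o);
  counitM21 : forall x y z : H, counit (x * y * z) =
    \sw_(y1, y2 <- comul y) (counit (x * y2) * counit (y1 * z) : k^o);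
  (* in (H ⊗ H) ⊗ H; [tassoc (1 ⊗ comul 1)] is 1_H ⊗ Delta(1_H) *)
  comul2_1 : tmap comul idfun (comul (1 : H)) =
    (comul (1 : H) ⊗ 1) * tassoc (1 ⊗ comul (1 : H)) :> (H ⊗ H) ⊗ H;
  comul2_1op : tmap comul idfun (comul (1 : H)) =
    tassoc (1 ⊗ comul (1 : H)) * (comul (1 : H) ⊗ 1) :> (H ⊗ H) ⊗ H
}.

#[short(type="weakBialgType")]
HB.structure Definition WeakBialgebra (k : fieldType) :=
  {H of GRing.Algebra k H & Coalgebra k H & isWeakBialgebra k H}.

Section TargetMap.
Variables (k : fieldType) (H : weakBialgType k).
Implicit Types x y z h : H.

(* h |-> counit (1_1 h) 1_2 *)
Definition target_map h : H :=
  \sw_(a, b <- comul (1 : H)) counit (a * h) *: b.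

Let target_bilin h : bilin (fun a b : H => counit (a * h) *: b).
Proof.
split=> [b c a1 a2|a c b1 b2] /=.
  by rewrite mulrDl -scalerAl linearP /= scalerDl scalerA.
by rewrite scalerDr !scalerA mulrC.
Qed.

Lemma target_map_linear : linear target_map.
Proof.
apply: tlift_linear_param => // a b c x y /=.
by rewrite mulrDr -scalerAr linearP /= scalerDl scalerA.
Qed.

HB.instance Definition _ :=
  GRing.isLinear.Build k H H *:%R target_map target_map_linear.

Lemma target_map1 : target_map 1 = 1.
Proof.
rewrite -[RHS]counitl /target_map; congr tlift.
by apply/funext => a; apply/funext => b; rewrite mulr1.
Qed.

Let sigG h : {f : {linear (H ⊗ H)%type -> H} |
  f =1 tlift (fun a b : H => counit (a * h) *: b)}.
Proof.
pose f : {linear (H ⊗ H)%type -> H} :=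
  HB.pack (tlift (fun a b : H => counit (a * h) *: b))
    (GRing.isLinear.Build k _ _ *:%R _ (tlift_linear (target_bilin h))).
by exists f.
Qed.
Let G h := sval (sigG h).

Let GE h : G h (comul 1) = target_map h.
Proof. exact: (svalP (sigG h)). Qed.

Let G_tens h a b : G h (a ⊗ b) = counit (a * h) *: b.
Proof. by rewrite (svalP (sigG h)) tlift_tens. Qed.

Let sigphi h : {f : {linear ((H ⊗ H) ⊗ H)%type -> (H ⊗ H)%type} |
  f =1 tmap (G h) idfun}.
Proof. by exists (tmap (G h) idfun). Qed.
Let phi h := sval (sigphi h).

Let phi_tens h (s : H ⊗ H) c : phi h (s ⊗ c) = G h s ⊗ c.
Proof. by rewrite (svalP (sigphi h)) tmap_tens. Qed.

Let phiP h c s t : phi h (c *: s + t) = c *: phi h s + phi h t.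
Proof. exact: linearP. Qed.

Let GP h c s t : G h (c *: s + t) = c *: G h s + G h t.
Proof. exact: linearP. Qed.

Let counit_bilin : bilin (fun a b : H => counit a *: b).
Proof.
split=> [b c a1 a2|a c b1 b2] /=; first by rewrite linearP /= scalerDl scalerA.
by rewrite scalerDr !scalerA mulrC.
Qed.

Let tassocP c (s t : H ⊗ (H ⊗ H)) :
  tassoc (c *: s + t) = c *: tassoc s + tassoc t.
Proof. exact: tassoc_linear. Qed.

Let phi_comul2 h (t : H ⊗ H) :
  phi h (tassoc (tmap idfun comul t)) = comul (G h t).
Proof.
elim/tensor_ind: t => [a b|c s t IHs IHt]; last first.
  rewrite (tmap_linear idfun comul c s t) tassocP phiP IHs IHt.
  by rewrite GP (linearP comul).
rewrite tmap_tens G_tens (linearZZ comul) /=.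
elim/tensor_ind: (comul b) => [c d|c s t IHs IHt].
  by rewrite tassoc_tens phi_tens G_tens tensZl.
by rewrite tensPr tassocP phiP IHs IHt scalerDr !scalerA mulrC.
Qed.

Let phi_mul h (s t : H ⊗ H) :
  phi h ((s ⊗ 1) * tassoc (1 ⊗ t)) = (G h s ⊗ 1) * t.
Proof.
elim/tensor_ind: s => [a b|c s1 s2 IH1 IH2]; last first.
  by rewrite GP !tensPl tensor_mulPl phiP IH1 IH2 tensor_mulPl.
elim/tensor_ind: t => [c d|c t1 t2 IH1 IH2]; last first.
  by rewrite tensPr tassocP tensor_mulPr phiP IH1 IH2 tensor_mulPr.
rewrite tassoc_tens !tensor_mulE phi_tens !G_tens.
by rewrite mulr1 scalerAl.
Qed.

Let phi_mulop h (s t : H ⊗ H) :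
  phi h (tassoc (1 ⊗ t) * (s ⊗ 1)) = t * (G h s ⊗ 1).
Proof.
elim/tensor_ind: s => [a b|c s1 s2 IH1 IH2]; last first.
  by rewrite GP !tensPl tensor_mulPr phiP IH1 IH2 tensor_mulPr.
elim/tensor_ind: t => [c d|c t1 t2 IH1 IH2]; last first.
  by rewrite tensPr tassocP tensor_mulPl phiP IH1 IH2 tensor_mulPl.
rewrite tassoc_tens !tensor_mulE phi_tens !G_tens.
by rewrite mul1r scalerAr.
Qed.

Lemma comul_target_map h :
  comul (target_map h) = (target_map h ⊗ 1) * comul (1 : H).
Proof. by rewrite -GE -phi_mul -comul2_1 comulA phi_comul2. Qed.

Lemma comul_target_map_op h :
  comul (target_map h) = comul (1 : H) * (target_map h ⊗ 1).
Proof. by rewrite -GE -phi_mulop -comul2_1op comulA phi_comul2. Qed.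

Lemma target_map_id z :
  comul z = comul (1 : H) * (z ⊗ 1) -> target_map z = z.
Proof.
move=> zE.
rewrite -[RHS]counitl zE -GE.
elim/tensor_ind: (comul 1) => [a b|c s t IHs IHt].
  by rewrite tensor_mulE mulr1 G_tens tlift_tens.
rewrite tensor_mulPl GP tlift_linear ?IHs ?IHt //.
Qed.

Definition target_subalgebra : {pred H} :=
  fun x => `[< exists h, target_map h = x >].

Lemma target_subalgebraP : subalg_closed target_subalgebra.
Proof.
split=> [|c x y /asboolP[h <-] /asboolP[g <-]|x y /asboolP[h <-] /asboolP[g <-]].
- by apply/asboolP; exists 1; exact: target_map1.
- by apply/asboolP; exists (c *: h + g); rewrite linearP.
have EE : comul (1 : H) * comul (1 : H) = comul (1 : H) :> H ⊗ H.
  by rewrite -comulM mulr1.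
apply/asboolP; exists (target_map h * target_map g); apply: target_map_id.
move: (comul_target_map h) (comul_target_map_op h) (comul_target_map_op g).
move: (target_map h) (target_map g) => u w uE uEop wEop; rewrite comulM.
rewrite uE wEop mulrA -[_ * _ * comul 1]mulrA EE -uE uEop -mulrA.
by rewrite tensor_mulE mulr1.
Qed.

HB.instance Definition _ :=
  GRing.isSubalgClosed.Build k H target_subalgebra
    (GRing.subalg_closed_semi target_subalgebraP).

Lemma target_mapP h : target_map h \in target_subalgebra.
Proof. by apply/asboolP; exists h. Qed.

Record target_alg := TargetAlg {
  target_val :> H;
  target_valP : target_val \in target_subalgebra }.

HB.instance Definition _ := [isSub for target_val].
HB.instance Definition _ := [Choice of target_alg by <:].
HB.instance Definition _ := [SubChoice_isSubAlgebra of target_alg by <:].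

Definition target_map_res (x : target_alg) : target_alg :=
  TargetAlg (target_mapP x).

Lemma target_map_res_linear : linear target_map_res.
Proof. by move=> c x y; apply: val_inj; rewrite /= linearP. Qed.

HB.instance Definition _ :=
  GRing.isLinear.Build k target_alg target_alg *:%R target_map_res
    target_map_res_linear.

End TargetMap.

Record left_module (k : fieldType) (B : algType k) := LeftModule {
  left_module_sort :> lmodType k;
  left_act : B -> left_module_sort -> left_module_sort;
  left_act_bilin : bilin left_act;
  left_act1 : forall m, left_act 1 m = m;
  left_actM : forall a b m, left_act (a * b) m = left_act a (left_act b m)
}.

Definition rota_baxter_paired (k : fieldType) (lambda : k) (B : algType k)
    (M : left_module B) (P : {linear B -> B}) (T : {linear M -> M}) : Prop :=
  forall (b : B) (m : M),
    left_act (P b) (T m) =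
      T (left_act (P b) m) + T (left_act b (T m)) + lambda *: T (left_act b m).

Definition generic_rota_baxter_paired (k : fieldType) (lambda : k)
    (B : algType k) (M : left_module B) (T : {linear M -> M}) : Prop :=
  forall P : {linear B -> B}, rota_baxter_paired lambda P T.

Definition rota_baxter_algebra (k : fieldType) (lambda : k) (B : algType k)
    (P : {linear B -> B}) : Prop :=
  forall x y : B, P x * P y = P (P x * y) + P (x * P y) + lambda *: P (x * y).

Section TargetModule.
Variables (k : fieldType) (H : weakBialgType k).

(* left multiplication by elements of the image of the target map *)
Definition target_act (x : target_alg H) (h : H) : H := target_val x * h.

Lemma target_act_bilin : bilin target_act.
Proof.
split=> [h c x y|x c h g]; rewrite /target_act /=.
  by rewrite mulrDl -scalerAl.
by rewrite mulrDr -scalerAr.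
Qed.

Lemma target_act1 h : target_act 1 h = h.
Proof. exact: mul1r. Qed.

Lemma target_actM x y h :
  target_act (x * y) h = target_act x (target_act y h).
Proof. by rewrite /target_act mulrA. Qed.

Definition target_module : left_module (target_alg H) :=
  LeftModule target_act_bilin target_act1 target_actM.

End TargetModule.

(* Main.v *)
Require Import Defs.
From mathcomp Require Import all_boot all_algebra.
From mathcomp Require Import boolp.

Set Implicit Arguments.
Unset Strict Implicit.
Unset Printing Implicit Defensive.

Import GRing.Theory.
Local Open Scope ring_scope.

(** The counit cannot distinguish [target_map y] from [y] on the right of a
    product, so [target_map (x * target_map y) = target_map (x * y)]. For [x] in
    the image of the target map the left-hand side is [x * target_map y], because
    this image is a subalgebra fixed pointwise by the target map. Thus the target
    map is an idempotent and left linear over its image, and in both Rota-Baxter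
    identities each of the four terms becomes, up to sign, the left-hand side or
    the same element [x * target_map y]. *)

Section TargetMapLinearity.
Variables (k : fieldType) (H : weakBialgType k).
Implicit Types x y z w h : H.

(** This is [counitM21] with middle factor 1: the scalar [counit (1_1 * y)] moves inside
    [counit (w * 1_2)]. *)
Lemma counit_mul_target_map w y : counit (w * target_map y) = counit (w * y).
Proof.
rewrite -[w in RHS]mulr1 counitM21 /target_map.
have counit_bilin : bilinear_for *:%R *:%R
    (fun a b : H => counit (w * b) * counit (a * y) : k^o).
  split=> [b c a1 a2|a c b1 b2] /=.
    by rewrite mulrDl -scalerAl linearP mulrDr mulrCA.
  by rewrite mulrDr -scalerAr linearP mulrDl -mulrA.
have target_bilin : bilinear_for *:%R *:%R
    (fun a b : H => counit (a * y) *: b).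
  split=> [b c a1 a2|a c b1 b2] /=.
    by rewrite mulrDl -scalerAl linearP /= scalerDl scalerA.
  by rewrite scalerDr !scalerA mulrC.
(* Both sides are linear in [comul 1], so pure tensors suffice. *)
elim/tensor_ind: (comul 1) => [a b|c s t IHs IHt].
  by rewrite !tlift_tens // -scalerAr linearZ /= mulrC.
by rewrite !tlift_linear // mulrDr -scalerAr linearP IHs IHt.
Qed.

Lemma target_map_mulr x y : target_map (x * target_map y) = target_map (x * y).
Proof.
rewrite [LHS]/target_map [RHS]/target_map; congr tlift.
apply/funext => a; apply/funext => b.
by rewrite mulrA counit_mul_target_map mulrA.
Qed.

Lemma target_map_fix z : z \in target_subalgebra (H := H) -> target_map z = z.
Proof. by move=> /asboolP[h <-]; exact/target_map_id/comul_target_map_op. Qed.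

Lemma target_map_mull z h :
  z \in target_subalgebra (H := H) -> target_map (z * h) = z * target_map h.
Proof.
move=> zL; rewrite -target_map_mulr target_map_fix //.
by apply: rpredM => //; exact: target_mapP.
Qed.

End TargetMapLinearity.

Theorem proposition3p6 (k : fieldType) (H : weakBialgType k) :
  @generic_rota_baxter_paired k (-1) (target_alg H) (target_module H)
    (@target_map k H) /\
  @rota_baxter_algebra k (-1) (target_alg H) (@target_map_res k H).
Proof.
have target_mapK (h : H) : target_map (target_map h) = target_map h.
  exact/target_map_fix/target_mapP.
split=> [P b m|x y].
  (* The left factors [P b] and [b] lie in the image whatever [P] is, so they come out of
     [target_map]. *)
  rewrite /= /target_act !target_map_mull ?target_valP //.
  by rewrite target_mapK scaleN1r addrK.
apply: val_inj; rewrite /= scaleN1r.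
(* On the image [target_map] is the identity, so each term is [x * y] up to sign. *)
rewrite !(target_map_mull, target_map_fix) ?rpredM ?target_mapP ?target_valP //.
by rewrite addrK.
Qed.
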